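(* Let $\phi=(\phi_0,\phi_1):\alpha\to\beta$ be a morphism of partial actions, where $\alpha$ is a partial action of a group $G$ on a set $X$, and let $(\mathcal R_\phi,K_\phi)$ be the partial action congruence on $\alpha$ determined by $\phi$, i.e. $x\sim_{\mathcal R_\phi}y\Leftrightarrow\phi_0(x)=\phi_0(y)$ and $K_\phi=\ker\phi_1$. If $(\mathcal R,K)$ is a partial action congruence on $\alpha$ such that $\mathcal R\subseteq\mathcal R_\phi$ and $K\subseteq K_\phi$, then there exists a unique morphism of partial actions $\varphi:\theta\to\beta$ such that $\phi=\varphi\circ\pi$, where $\theta$ is the quotient partial action of $\alpha$ by $(\mathcal R,K)$ and $\pi:\alpha\to\theta$ is the quotient morphism.
   Context: Partial action: $\alpha=(G,X,\{X_g\},\{\alpha_g\})$ of a group $G$ on a set $X$ consists of subsets $X_g\subseteq X$ and bijections $\alpha_g:X_{g^{-1}}\to X_g$ such that (i) $X_1=X$, $\alpha_1=1_X$; (ii) $\alpha_g(X_{g^{-1}}\cap X_{g^{-1}h})\subseteq X_g\cap X_h$; (iii) $\alpha_g\alpha_h(x)=\alpha_{gh}(x)$ for $x\in X_{h^{-1}}\cap X_{h^{-1}g^{-1}}$. A morphism from $(G,X,\{X_g\},\{\alpha_g\})$ to $(S,Y,\{Y_s\},\{\beta_s\})$ is a pair $(\phi_0,\phi_1)$, $\phi_0:X\to Y$ a map, $\phi_1:G\to S$ a group homomorphism, with $\phi_0(X_g)\subseteq Y_{\phi_1(g)}$ and $\phi_0(\alpha_g(x))=\beta_{\phi_1(g)}(\phi_0(x))$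 for $x\in X_{g^{-1}}$. $\mathcal R$-chain (for an equivalence relation $\mathcal R$ on $X$): a tuple $\mathfrak c=((x_1,g_1),\dots,(x_n,g_n))$, $n\ge1$, with $x_i\in X_{g_i}$ and $\alpha_{g_{i-1}^{-1}}(x_{i-1})\sim_{\mathcal R}x_i$ for $1<i\le n$; $\operatorname{t}(\mathfrak c)=x_1$, $\operatorname{s}(\mathfrak c)=\alpha_{g_n^{-1}}(x_n)$, $\epsilon(\mathfrak c)=g_1\cdots g_n$. Partial action congruence: a pair $(\mathcal R,K)$, $\mathcal R$ an equivalence relation on $X$, $K\trianglelefteq G$, such that for all $\mathcal R$-chains $\mathfrak c,\mathfrak o$ with $\epsilon(\mathfrak c)K=\epsilon(\mathfrak o)K$: $\operatorname{s}(\mathfrak c)\sim\operatorname{s}(\mathfrak o)\Leftrightarrow\operatorname{t}(\mathfrak c)\sim\operatorname{t}(\mathfrak o)$. The pair $(\mathcal R_\phi,K_\phi)$ is always a partial action congruence. Quotient partial action of $\alpha$ by a congruence $(\mathcal R,K)$: the partial action $\theta$ of $\overline G=G/K$ on $\overline X=X/\mathcal R$ with $D_{\overline g}=\{\overline{\operatorname{t}(\mathfrak c)}:\mathfrak c\text{ an }\mathcal R\text{-chain},\ \overline{\epsilon(\mathfrak c)}=\overline g\}$ and $\theta_{\overline g}(\overline{\operatorname{s}(\mathfrak c)})=\overline{\operatorname{t}(\mathfrak c)}$ for $\overline{\epsilon(\mathfrak c)}=\overline g$. The quotient morphism $\pi=(\pi_0,\pi_1):\alpha\to\theta$ is given by the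 canonical projections. *)

(* Defs.v *)
From Corelib.Classes Require RelationClasses.
From HB Require Import structures.
From mathcomp Require Import all_boot generic_quotient.
From mathcomp Require Import boolp classical_sets functions.

Set Implicit Arguments.
Unset Strict Implicit.
Unset Printing Implicit Defensive.

Import Algebra.
Local Open Scope classical_set_scope.
Local Open Scope quotient_scope.
Local Open Scope group_scope.

Section Classes.
Variables (T : Type) (R : T -> T -> Prop) (eqR : RelationClasses.Equivalence R).

Definition class_rel : rel {classic T} := fun x y => `[< R x y >].

Lemma class_rel_refl : reflexive class_rel.
Proof. by move=> x; apply/asboolP; case: eqR => r _ _; apply: r. Qed.

Lemma class_rel_sym : symmetric class_rel.
Proof.
by move=> x y; case: eqR => _ s _; apply/asboolP/asboolP => xy; apply: s.
Qed.

Lemma class_rel_trans : transitive class_rel.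
Proof.
move=> y x z /asboolP xy /asboolP yz; apply/asboolP.
by case: eqR => _ _ t; apply: t xy yz.
Qed.

Definition class_equiv : equiv_rel {classic T} :=
  EquivRel class_rel class_rel_refl class_rel_sym class_rel_trans.

Definition class_quot := {eq_quot class_equiv}.
HB.instance Definition _ := Choice.on class_quot.

Definition class_of (x : T) : class_quot := (\pi_({eq_quot class_equiv}) x)%qT.

Lemma class_ofP x y : class_of x = class_of y <-> R x y.
Proof.
split=> [/eqmodP/asboolP //|xy].
by apply/(@eqmodP _ class_equiv); apply/asboolP.
Qed.

Lemma class_of_surj (q : class_quot) : exists x, class_of x = q.
Proof. by exists (repr (q : {eq_quot class_equiv})); rewrite /class_of reprK. Qed.

End Classes.

Record normal_subgroup (G : groupType) := NormalSubgroup {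
  normal_set :> set G;
  normal1 : normal_set 1;
  normalM : forall x y, normal_set x -> normal_set y -> normal_set (x * y);
  normalV : forall x, normal_set x -> normal_set x^-1;
  normalJ : forall x g, normal_set x -> normal_set (x ^ g) }.

Section QuotientGroup.
Variables (G : groupType) (K : normal_subgroup G).

(* x and y lie in the same left coset of K *)
Definition coset_rel (x y : G) : Prop := normal_set K (x^-1 * y).

Lemma coset_rel_equiv : RelationClasses.Equivalence coset_rel.
Proof.
rewrite /coset_rel; split.
- by move=> x; rewrite mulVg; apply: normal1.
- by move=> x y /normalV; rewrite invgM invgK.
- by move=> x y z xy /(normalM xy); rewrite mulgA mulgK.
Qed.

Definition quot_group := class_quot coset_rel_equiv.
HB.instance Definition _ := Choice.on quot_group.

Definition coset (x : G) : quot_group := class_of coset_rel_equiv x.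

Lemma cosetP x y : coset x = coset y <-> normal_set K (x^-1 * y).
Proof. exact: class_ofP. Qed.

Lemma coset_surj (q : quot_group) : exists x, coset x = q.
Proof. exact: class_of_surj. Qed.

Definition coset_repr (q : quot_group) : G := projT1 (cid (coset_surj q)).

Lemma coset_reprK : cancel coset_repr coset.
Proof. by move=> q; rewrite /coset_repr; case: cid. Qed.

Definition quot_mul (p q : quot_group) := coset (coset_repr p * coset_repr q).
Definition quot_inv (p : quot_group) := coset (coset_repr p)^-1.

Lemma quot_mulE x y : quot_mul (coset x) (coset y) = coset (x * y).
Proof.
have /cosetP Kx := coset_reprK (coset x).
have /cosetP Ky := coset_reprK (coset y).
apply/cosetP; move: Kx Ky; set a := coset_repr _; set b := coset_repr _.
move=> /(normalJ y) Kx Ky; have := normalM Ky Kx.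
by rewrite invgM /conjg !mulgA mulgK.
Qed.

Lemma quot_invE x : quot_inv (coset x) = coset x^-1.
Proof.
have /cosetP Kx := coset_reprK (coset x).
apply/cosetP; move: Kx; set a := coset_repr _.
move=> /normalV /(normalJ x^-1).
by rewrite invgM !invgK /conjg invgK !mulgA mulgV mul1g.
Qed.

Lemma quot_mulA : associative quot_mul.
Proof.
move=> p q r; case: (coset_surj p) (coset_surj q) (coset_surj r).
by move=> x <- [y <-] [z <-]; rewrite !quot_mulE mulgA.
Qed.

Lemma quot_mul1 : left_id (coset 1) quot_mul.
Proof. by move=> p; case: (coset_surj p) => x <-; rewrite quot_mulE mul1g. Qed.

Lemma quot_1mul : right_id (coset 1) quot_mul.
Proof. by move=> p; case: (coset_surj p) => x <-; rewrite quot_mulE mulg1. Qed.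

Lemma quot_mulV : left_inverse (coset 1) quot_inv quot_mul.
Proof.
by move=> p; case: (coset_surj p) => x <-; rewrite quot_invE quot_mulE mulVg.
Qed.

Lemma quot_Vmul : right_inverse (coset 1) quot_inv quot_mul.
Proof.
by move=> p; case: (coset_surj p) => x <-; rewrite quot_invE quot_mulE mulgV.
Qed.

HB.instance Definition _ := isGroup.Build quot_group
  quot_mulA quot_mul1 quot_1mul quot_mulV quot_Vmul.

Lemma coset_monoid_morphism : monoid_morphism coset.
Proof. by split=> // x y; rewrite -quot_mulE. Qed.

HB.instance Definition _ :=
  isUMagmaMorphism.Build G quot_group coset coset_monoid_morphism.

End QuotientGroup.

(* [pa_dom g] is X_g.  The bijection alpha_g is encoded by a total function,
   whose values outside X_{g^-1} are unspecified and never used. *)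
Record partial_action (G : groupType) (X : Type) := PartialAction {
  pa_dom : G -> set X;
  pa_act : G -> X -> X;
  pa_bij : forall g, set_bij (pa_dom g^-1) (pa_dom g) (pa_act g);
  pa_dom1 : pa_dom 1 = setT;
  pa_act1 : forall x, pa_act 1 x = x;
  pa_actI : forall g h,
    pa_act g @` (pa_dom g^-1 `&` pa_dom (g^-1 * h)) `<=` pa_dom g `&` pa_dom h;
  pa_actM : forall g h x, (pa_dom h^-1 `&` pa_dom (h^-1 * g^-1)) x ->
    pa_act g (pa_act h x) = pa_act (g * h) x }.

Record pa_morphism (G S : groupType) (X Y : Type)
    (alpha : partial_action G X) (beta : partial_action S Y) := PaMorphism {
  mor0 : X -> Y;
  mor1 : UMagmaMorphism.type G S;
  mor_dom : forall g, mor0 @` pa_dom alpha g `<=` pa_dom beta (mor1 g);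
  mor_act : forall g x, pa_dom alpha g^-1 x ->
    mor0 (pa_act alpha g x) = pa_act beta (mor1 g) (mor0 x) }.

Section Composition.
Variables (G H S : groupType) (X Y Z : Type).
Variables (alpha : partial_action G X) (beta : partial_action H Y).
Variables (gamma : partial_action S Z).
Variables (psi : pa_morphism beta gamma) (phi : pa_morphism alpha beta).

Definition comp0 : X -> Z := mor0 psi \o mor0 phi.
Definition comp1 : UMagmaMorphism.type G S := mor1 psi \o mor1 phi.

Lemma comp_dom g : comp0 @` pa_dom alpha g `<=` pa_dom gamma (comp1 g).
Proof.
by move=> _ [x gx <-]; apply: mor_dom; exists (mor0 phi x) => //;
   apply: mor_dom; exists x.
Qed.

Lemma comp_act g x : pa_dom alpha g^-1 x ->
  comp0 (pa_act alpha g x) = pa_act gamma (comp1 g) (comp0 x).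
Proof.
move=> gx; rewrite /comp0 /= (mor_act phi gx) mor_act //.
by rewrite -gmulfV; apply: mor_dom; exists x.
Qed.

Definition pa_comp : pa_morphism alpha gamma := PaMorphism comp_dom comp_act.

End Composition.

Section Facts.
Variables (G : groupType) (X : Type) (alpha : partial_action G X).
Implicit Types (g h : G) (x : X).

Lemma pa_act_dom g x : pa_dom alpha g^-1 x -> pa_dom alpha g (pa_act alpha g x).
Proof. by case: (pa_bij alpha g) => f _ _ gx; apply: f. Qed.

Lemma pa_actV_dom g x :
  pa_dom alpha g x -> pa_dom alpha g^-1 (pa_act alpha g^-1 x).
Proof. by move=> gx; apply: pa_act_dom; rewrite invgK. Qed.

Lemma pa_actVK g x : pa_dom alpha g x -> pa_act alpha g (pa_act alpha g^-1 x) = x.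
Proof.
move=> gx; rewrite pa_actM ?mulgV ?pa_act1 //.
by rewrite invgK mulgV pa_dom1.
Qed.

Lemma pa_actK g x :
  pa_dom alpha g^-1 x -> pa_act alpha g^-1 (pa_act alpha g x) = x.
Proof.
by move=> gx; rewrite pa_actM ?mulVg ?pa_act1 // invgK mulVg pa_dom1.
Qed.

End Facts.

Section Chains.
Variables (G : groupType) (X : Type) (alpha : partial_action G X).
Variable R : X -> X -> Prop.

Definition link_source (p : X * G) : X := pa_act alpha p.2^-1 p.1.

Definition is_link (p : X * G) : bool := `[< pa_dom alpha p.2 p.1 >].

Definition linked (p q : X * G) : bool := `[< R (link_source p) q.1 >].

(* The chain ((x_1,g_1),...,(x_n,g_n)) is stored as its head (x_1,g_1)
   and the sequence of its other entries, so that n >= 1. *)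
Record chain := Chain {
  chain_head : X * G;
  chain_tail : seq (X * G);
  chain_links : all is_link (chain_head :: chain_tail);
  chain_path : path linked chain_head chain_tail }.

Definition target (c : chain) : X := (chain_head c).1.
Definition source (c : chain) : X :=
  link_source (last (chain_head c) (chain_tail c)).
Definition chain_prod (c : chain) : G :=
  \prod_(p <- chain_head c :: chain_tail c) p.2.

Lemma chain1_subproof x g : pa_dom alpha g x -> all is_link [:: (x, g)].
Proof. by move=> gx; rewrite /= andbT; apply/asboolP. Qed.

Definition chain1 x g (gx : pa_dom alpha g x) : chain :=
  @Chain (x, g) [::] (chain1_subproof gx) isT.

Lemma target1 x g (gx : pa_dom alpha g x) : target (chain1 gx) = x.
Proof. by []. Qed.

Lemma source1 x g (gx : pa_dom alpha g x) :
  source (chain1 gx) = pa_act alpha g^-1 x.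
Proof. by []. Qed.

Lemma chain_prod1 x g (gx : pa_dom alpha g x) : chain_prod (chain1 gx) = g.
Proof. by rewrite /chain_prod big_seq1. Qed.

Lemma chain_cat (c o : chain) : R (source c) (target o) ->
  exists d, [/\ target d = target c, source d = source o
              & chain_prod d = chain_prod c * chain_prod o].
Proof.
case: c o => [p c cl cp] [q o ol op] /asboolP co.
have l : all is_link (p :: (c ++ q :: o)).
  by rewrite -cat_cons all_cat cl.
have k : path linked p (c ++ q :: o) by rewrite cat_path cp /= op andbT.
exists (Chain l k); split=> //=.
- by rewrite /source /= last_cat.
- by rewrite /chain_prod /= -cat_cons big_cat.
Qed.

Lemma chain_ind (P : X -> G -> X -> Prop) :
  (forall x g, pa_dom alpha g x -> P x g (pa_act alpha g^-1 x)) ->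
  (forall x g y h z, pa_dom alpha g x -> R (pa_act alpha g^-1 x) y ->
     P y h z -> P x (g * h) z) ->
  forall c, P (target c) (chain_prod c) (source c).
Proof.
move=> P1 P2 [p c]; rewrite /target /chain_prod /source /=.
elim: c p => [|q c IH] [x g] /=.
  by move=> /andP[/asboolP gx _] _; rewrite big_seq1; apply: P1.
move=> /andP[/asboolP gx cl] /andP[/asboolP Rx cp].
by rewrite big_cons; apply: (P2 _ _ q.1) => //; apply: IH.
Qed.

Lemma chain_inv : RelationClasses.Equivalence R -> forall c : chain,
  exists d : chain, [/\ target d = source c, source d = target c
              & chain_prod d = (chain_prod c)^-1].
Proof.
move=> [_ Rsym _].
pose P x g y := exists d, [/\ target d = y, source d = x & chain_prod d = g^-1].
apply: (chain_ind (P := P)) => [x g gx|x g y h z gx Rxy [d [dt ds de]]].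
  exists (chain1 (pa_actV_dom gx)).
  by rewrite target1 source1 chain_prod1 invgK pa_actVK.
have [|e [et es ee]] := @chain_cat d (chain1 (pa_actV_dom gx)).
  by rewrite ds target1; apply: Rsym.
exists e; rewrite et es ee; split=> //.
  by rewrite source1 invgK pa_actVK.
by rewrite chain_prod1 de invgM.
Qed.

End Chains.

Record pa_congruence (G : groupType) (X : Type) (alpha : partial_action G X) :=
  PaCongruence {
  cong_rel : X -> X -> Prop;
  cong_group : normal_subgroup G;
  cong_equiv : RelationClasses.Equivalence cong_rel;
  congP : forall c o : chain alpha cong_rel,
    coset cong_group (chain_prod c) = coset cong_group (chain_prod o) ->
    (cong_rel (source c) (source o) <-> cong_rel (target c) (target o)) }.

Section KernelCongruence.
Variables (G S : groupType) (X Y : Type).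
Variables (alpha : partial_action G X) (beta : partial_action S Y).
Variable phi : pa_morphism alpha beta.

Definition ker_rel (x y : X) : Prop := mor0 phi x = mor0 phi y.

Lemma ker_rel_equiv : RelationClasses.Equivalence ker_rel.
Proof.
by rewrite /ker_rel; split=> [x|x y|x y z] //; apply: etrans.
Qed.

Definition ker_set : set G := [set g | mor1 phi g = 1].

Lemma ker_set1 : ker_set 1.
Proof. exact: gmulf1. Qed.

Lemma ker_setM x y : ker_set x -> ker_set y -> ker_set (x * y).
Proof. by rewrite /ker_set /= gmulfM => -> ->; rewrite mulg1. Qed.

Lemma ker_setV x : ker_set x -> ker_set x^-1.
Proof. by rewrite /ker_set /= gmulfV => ->; rewrite invg1. Qed.

Lemma ker_setJ x g : ker_set x -> ker_set (x ^ g).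
Proof. by rewrite /ker_set /= gmulfJ => ->; rewrite conj1g. Qed.

Definition ker_group : normal_subgroup G :=
  NormalSubgroup ker_set1 ker_setM ker_setV ker_setJ.

Lemma ker_chain (c : chain alpha ker_rel) :
  pa_dom beta (mor1 phi (chain_prod c))^-1 (mor0 phi (source c)) /\
  pa_act beta (mor1 phi (chain_prod c)) (mor0 phi (source c)) =
    mor0 phi (target c).
Proof.
pose P x g z := pa_dom beta (mor1 phi g)^-1 (mor0 phi z) /\
  pa_act beta (mor1 phi g) (mor0 phi z) = mor0 phi x.
apply: (chain_ind (P := P)) => {c}.
  move=> x g gx; have gx' := pa_actV_dom gx.
  split; first by rewrite -gmulfV; apply: mor_dom; exists (pa_act alpha g^-1 x).
  by rewrite -mor_act // pa_actVK.
move=> x g y h z gx Rxy [hz hzy]; have gx' := pa_actV_dom gx.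
have gy : pa_dom beta (mor1 phi g)^-1 (mor0 phi y).
  by rewrite -Rxy -gmulfV; apply: mor_dom; exists (pa_act alpha g^-1 x).
have ghz : (pa_dom beta (mor1 phi h)^-1 `&`
    pa_dom beta ((mor1 phi h)^-1 * (mor1 phi g)^-1)) (mor0 phi z).
  split=> //; rewrite -(pa_actK hz) hzy.
  suff [] : (pa_dom beta (mor1 phi h)^-1 `&`
    pa_dom beta ((mor1 phi h)^-1 * (mor1 phi g)^-1))
    (pa_act beta (mor1 phi h)^-1 (mor0 phi y)) by [].
  apply: pa_actI; exists (mor0 phi y) => //.
  by rewrite invgK mulVKg -hzy; split; [exact: pa_act_dom|rewrite hzy].
rewrite /P gmulfM; split; first by rewrite invgM; case: ghz.
by rewrite -pa_actM // hzy -Rxy -mor_act // pa_actVK.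
Qed.

Lemma ker_congP (c o : chain alpha ker_rel) :
  coset ker_group (chain_prod c) = coset ker_group (chain_prod o) ->
  (ker_rel (source c) (source o) <-> ker_rel (target c) (target o)).
Proof.
move=> /cosetP /= ; rewrite /ker_set /= gmulfM gmulfV => eco.
have {eco}eco : mor1 phi (chain_prod c) = mor1 phi (chain_prod o).
  by rewrite -[RHS](mulVKg (mor1 phi (chain_prod c))) eco mulg1.
have [cd ca] := ker_chain c; have [od oa] := ker_chain o.
rewrite /ker_rel -ca -oa eco; split=> [-> //|].
case: (pa_bij beta (mor1 phi (chain_prod o))) => _ inj _.
by rewrite eco in cd; apply: inj; rewrite inE.
Qed.

Definition ker_congruence : pa_congruence alpha :=
  PaCongruence ker_rel_equiv ker_congP.

End KernelCongruence.

Section QuotientAction.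
Variables (G : groupType) (X : Type) (alpha : partial_action G X).
Variable C : pa_congruence alpha.

Let R := cong_rel C.
Let K := cong_group C.

Definition quot_set := class_quot (cong_equiv C).
Definition qclass (x : X) : quot_set := class_of (cong_equiv C) x.

Definition quot_dom (q : quot_group K) : set quot_set :=
  [set z | exists c : chain alpha R,
             coset K (chain_prod c) = q /\ z = qclass (target c)].

(* The chain is picked by choice; [quot_actE] shows that theta_q does not depend
   on it. Outside the domain of theta_q the value is irrelevant. *)
Definition quot_act (q : quot_group K) (z : quot_set) : quot_set :=
  match pselect (exists c : chain alpha R,
                   coset K (chain_prod c) = q /\ z = qclass (source c)) with
  | left cP => qclass (target (projT1 (cid cP)))
  | right _ => z
  end.

Lemma quot_actE (c : chain alpha R) :
  quot_act (coset K (chain_prod c)) (qclass (source c)) = qclass (target c).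
Proof.
rewrite /quot_act; case: pselect => [cP|[]]; last by exists c.
case: cid => o [eo so] /=; apply/class_ofP.
by apply/(congP eo)/(class_ofP (cong_equiv C)).
Qed.

Lemma quot_domV (q : quot_group K) z : quot_dom q^-1 z <->
  exists c : chain alpha R, coset K (chain_prod c) = q /\ z = qclass (source c).
Proof.
have cV := chain_inv (cong_equiv C).
split=> [] [c [ec ->]]; have [d [dt ds de]] := cV _ _ c; exists d.
  by rewrite de ds gmulfV /= ec invgK.
by rewrite de dt gmulfV /= ec.
Qed.

Lemma quot_act_bij q : set_bij (quot_dom q^-1) (quot_dom q) (quot_act q).
Proof.
split.
- by move=> z /quot_domV[c [<- ->]]; exists c; rewrite quot_actE.
- move=> y z /set_mem/quot_domV[c [ec ->]] /set_mem/quot_domV[o [eo ->]].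
  rewrite -{1}ec quot_actE -eo quot_actE => /class_ofP co; apply/class_ofP.
  by apply/congP => //; rewrite ec eo.
- move=> _ [c [ec ->]]; exists (qclass (source c)); last by rewrite -ec quot_actE.
  by apply/quot_domV; exists c.
Qed.

Lemma quot_dom1 : quot_dom 1 = setT.
Proof.
apply/seteqP; split=> // z _; have [x <-] := class_of_surj z.
have x1 : pa_dom alpha 1 x by rewrite pa_dom1.
by exists (chain1 R x1); rewrite chain_prod1 gmulf1.
Qed.

Lemma quot_act1 z : quot_act 1 z = z.
Proof.
have [x <-] := class_of_surj z.
have x1 : pa_dom alpha 1 x by rewrite pa_dom1.
have := quot_actE (chain1 R x1).
by rewrite chain_prod1 gmulf1 source1 target1 invg1 pa_act1.
Qed.

Lemma quot_actI p q : quot_act p @` (quot_dom p^-1 `&` quot_dom (p^-1 * q))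
  `<=` quot_dom p `&` quot_dom q.
Proof.
move=> _ [z [/quot_domV[c [ec zc]] [o [eo zo]]] <-].
have -> : quot_act p z = qclass (target c) by rewrite zc -ec quot_actE.
split; first by exists c.
have [|d [dt ds de]] := @chain_cat _ _ alpha R c o.
  by apply/(class_ofP (cong_equiv C)); rewrite -/(qclass _) -zc zo.
by exists d; rewrite de dt gmulfM /= ec eo mulVKg.
Qed.

Lemma quot_actM p q z : (quot_dom q^-1 `&` quot_dom (q^-1 * p^-1)) z ->
  quot_act p (quot_act q z) = quot_act (p * q) z.
Proof.
rewrite -invgM => -[/quot_domV[c [ec zc]] /quot_domV[o [eo zo]]].
have -> : quot_act q z = qclass (target c) by rewrite zc -ec quot_actE.
have -> : quot_act (p * q) z = qclass (target o) by rewrite zo -eo quot_actE.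
have [d [dt ds de]] := chain_inv (cong_equiv C) c.
have [|e [et es ee]] := @chain_cat _ _ alpha R o d.
  by apply/(class_ofP (cong_equiv C)); rewrite -/(qclass _) -zo zc dt.
by rewrite -ds -es -et -quot_actE ee gmulfM /= de gmulfV /= ec eo mulgK.
Qed.

Definition quot_action : partial_action (quot_group K) quot_set :=
  PartialAction quot_act_bij quot_dom1 quot_act1 quot_actI quot_actM.

Lemma quot_mor_dom g : qclass @` pa_dom alpha g `<=` pa_dom quot_action (coset K g).
Proof.
by move=> _ [x gx <-]; exists (chain1 R gx); rewrite chain_prod1 target1.
Qed.

Lemma quot_mor_act g x : pa_dom alpha g^-1 x ->
  qclass (pa_act alpha g x) = pa_act quot_action (coset K g) (qclass x).
Proof.
move=> gx; have := quot_actE (chain1 R (pa_act_dom gx)).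
by rewrite chain_prod1 target1 source1 pa_actK.
Qed.

Definition quot_morphism : pa_morphism alpha quot_action :=
  @PaMorphism _ _ _ _ alpha quot_action qclass (coset K)
    quot_mor_dom quot_mor_act.

End QuotientAction.

(* Main.v *)
(** Since [R] refines [R_phi], every [R]-chain is an [R_phi]-chain, and [phi]
    sends an [R_phi]-chain [c] to an instance of [beta] at [phi_1 (eps c)] taking
    [phi_0 (s c)] to [phi_0 (t c)].  As [theta] is defined by [R]-chains, the maps
    induced by [phi_0] and [phi_1] on the quotients form a morphism; it is unique
    because both projections are surjective. *)
Require Import Defs.
From HB Require Import structures.
From mathcomp Require Import all_boot.
From mathcomp Require Import boolp classical_sets functions.
Local Open Scope classical_set_scope.
Local Open Scope group_scope.
Import Algebra.

(** A sigma type, so that [coset_lift] can return its morphism as data; the lift evaluates [f] at a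
    chosen representative. *)
Lemma class_of_lift {T U : Type} {R : T -> T -> Prop}
    (eqR : RelationClasses.Equivalence R) {f : T -> U} :
  (forall x y, R x y -> f x = f y) ->
  {g : class_quot eqR -> U | forall x, g (class_of eqR x) = f x}.
Proof.
move=> fR; exists (fun q => f (projT1 (cid (class_of_surj q)))) => x.
by case: cid => y /= /class_ofP/fR.
Qed.

Lemma coset_lift {G S : groupType} {K : normal_subgroup G}
    {f : UMagmaMorphism.type G S} :
  (forall x, normal_set K x -> f x = 1) ->
  {g : UMagmaMorphism.type (quot_group K) S | forall x, g (coset K x) = f x}.
Proof.
move=> fK.
have fR x y : coset_rel K x y -> f x = f y.
  move=> /fK; rewrite gmulfM gmulfV => fxy.
  by rewrite -[RHS](mulVKg (f x)) fxy mulg1.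
have [g gE] : {g : quot_group K -> S | forall x, g (coset K x) = f x}.
  exact: class_of_lift fR.
have gM : monoid_morphism g.
  split; first by have := gE 1; rewrite !gmulf1.
  move=> p q; have [x <-] := coset_surj p; have [y <-] := coset_surj q.
  by rewrite -gmulfM !gE gmulfM.
pose gm := isUMagmaMorphism.Build _ _ g gM.
by exists (HB.pack_for (UMagmaMorphism.type (quot_group K) S) g gm).
Qed.

(** The remaining fields are proofs, equal by proof irrelevance once transported along the equality
    of functions. *)
Lemma umagma_morphism_eq (G S : groupType) (f g : UMagmaMorphism.type G S) :
  f =1 g -> f = g.
Proof.
case: f g => [f [[fM] [f1]]] [g [[gM] [g1]]] /= /funext fg.
by case: _ / fg gM g1 => gM g1; rewrite (Prop_irrelevance fM gM)
  (Prop_irrelevance f1 g1).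
Qed.

Lemma pa_morphism_eq (G S : groupType) (X Y : Type)
    (alpha : partial_action G X) (beta : partial_action S Y)
    (phi psi : pa_morphism alpha beta) :
  mor0 phi =1 mor0 psi -> mor1 phi =1 mor1 psi -> phi = psi.
Proof.
case: phi psi => [f0 f1 fd fa] [g0 g1 gd ga] /= /funext e0.
move=> /umagma_morphism_eq e1; subst g0 g1.
by rewrite (Prop_irrelevance fd gd) (Prop_irrelevance fa ga).
Qed.

(** The relation enters a chain only through [linked], so the same list of pairs serves for the
    coarser [R']. *)
Lemma chain_mono {G : groupType} {X : Type} {alpha : partial_action G X}
    {R R' : X -> X -> Prop} :
  (forall x y, R x y -> R' x y) -> forall c : chain alpha R,
  exists d : chain alpha R', [/\ target d = target c, source d = source c
              & chain_prod d = chain_prod c].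
Proof.
move=> RR' [p c cl cp].
have cp' : path (linked alpha R') p c.
  by apply: sub_path cp => a b /asboolP/RR' ab; apply/asboolP.
by exists (Chain cl cp').
Qed.

Theorem proposition1p15 (G S : groupType) (X Y : Type)
    (alpha : partial_action G X) (beta : partial_action S Y)
    (phi : pa_morphism alpha beta) (C : pa_congruence alpha) :
  (forall x y : X, cong_rel C x y -> cong_rel (ker_congruence phi) x y) ->
  cong_group C `<=` cong_group (ker_congruence phi) ->
  exists! psi : pa_morphism (quot_action C) beta,
    phi = pa_comp psi (quot_morphism C).
Proof.
move=> Rphi Kphi.
have [f0 f0E] := class_of_lift (cong_equiv C) Rphi.
have [f1 f1E] := coset_lift Kphi.
have chainE (c : chain alpha (cong_rel C)) :
    pa_dom beta (mor1 phi (chain_prod c))^-1 (mor0 phi (source c)) /\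
    pa_act beta (mor1 phi (chain_prod c)) (mor0 phi (source c)) =
      mor0 phi (target c).
  by have [d [<- <- <-]] := chain_mono Rphi c; apply: ker_chain.
have fdom q : f0 @` pa_dom (quot_action C) q `<=` pa_dom beta (f1 q).
  (* A point of the domain at [q] is the class of some [target c]; by [chainE] its image is a value
     of [beta] at [mor1 phi (chain_prod c)], hence in the range. *)
  move=> _ [_ [c [<- ->]] <-]; rewrite f1E f0E.
  by have [cd <-] := chainE c; apply: pa_act_dom.
have fact q z : pa_dom (quot_action C) q^-1 z ->
    f0 (pa_act (quot_action C) q z) = pa_act beta (f1 q) (f0 z).
  (* Points of the domain at [q^-1] are classes of sources of chains with product in [q], where
     [quot_actE] computes the action. *)
  move=> /quot_domV[c [<- ->]]; rewrite /= quot_actE !f0E f1E.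
  by have [_ ->] := chainE c.
exists (PaMorphism fdom fact); split.
  by apply: pa_morphism_eq => x; rewrite /= ?f1E // /comp0 /= f0E.
move=> psi phiE; apply: pa_morphism_eq => [z|q] /=.
  by have [x <-] := class_of_surj z; rewrite f0E phiE.
by have [x <-] := coset_surj q; rewrite f1E phiE.
Qed.
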